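(* Let $n\in\{2,3\}$. Let $\varphi:\mathbb{R}\to[0,\infty)$ be a bounded Borel measurable function with $\mathrm{supp}(\varphi)\subset\,]-\infty,M]$ for some $M\in\mathbb{R}$. Let $\Phi:\mathbb{R}^n\to \mathbb{R}$ and $a:\mathbb{R}^n\times\mathbb{R}^n\to [0,\infty)$ be two measurable functions, and set $$f_0(x,v)=\varphi\left(|v|^2+\Phi(x)+a(x,v)\right).$$ Assume that $\rho_0(x)=\int_{\mathbb{R}^n} f_0(x,v)\,dv$ has compact support contained in a measurable set $B\subset \mathbb{R}^n$, and that for some constant $C_0$ $$\forall p\geq 1,\quad \int_{B}\left(M-\Phi(x)\right)_+^{p}\,dx\leq (C_0 p)^{\frac{2p}{n}}.$$ Then for every nonnegative $h_0\in L^\infty(\mathbb{R}^n\times \mathbb{R}^n)$, the density $g_0=f_0h_0$ has the following properties: $g_0$ is nonnegative, $g_0\in L^1\cap L^\infty(\mathbb{R}^n\times\mathbb{R}^n)$, $\iint |v|^m g_0(x,v)\,dx\,dv<+\infty$ for some $m>n^2-n$, and there is a constant $C_1$ such that $$\forall k\geq 1,\quad \iint_{\mathbb{R}^n\times \mathbb{R}^n} |v|^k g_0(x,v)\,dx\,dv\leq (C_1 k)^{\frac{k}{n}}.$$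
   Context: $s_+=\max(s,0)$ denotes the positive part. The parameters $p$ and $k$ range over real numbers $\geq 1$. *)

(* Defs.v *)
From HB Require Import structures.
From mathcomp Require Import all_boot all_order all_algebra.
From mathcomp Require Import all_classical all_reals all_analysis.

Set Implicit Arguments.
Unset Strict Implicit.
Unset Printing Implicit Defensive.

Import Order.TTheory GRing.Theory Num.Theory.
Import numFieldNormedType.Exports.

Local Open Scope classical_set_scope.
Local Open Scope ring_scope.

(* The product (= Borel) sigma-algebra on R^n, generated by the coordinates. *)
Definition rV_display : measure_display. Proof. exact: default_measure_display. Qed.

Section measurable_rV.
Context {R : realType} (n : nat).

Let coor (i : 'I_n) (x : 'rV[R]_n) : R := x ord0 i.

Let rV_set0 : g_sigma_preimage coor set0.
Proof. exact: sigma_algebra0. Qed.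

Let rV_setC A : g_sigma_preimage coor A -> g_sigma_preimage coor (~` A).
Proof. exact: sigma_algebraC. Qed.

Let rV_bigcup (F : _^nat) : (forall i, g_sigma_preimage coor (F i)) ->
  g_sigma_preimage coor (\bigcup_i (F i)).
Proof. exact: sigma_algebra_bigcup. Qed.

HB.instance Definition _ := @isMeasurable.Build rV_display
  'rV[R]_n (g_sigma_preimage coor) rV_set0 rV_setC rV_bigcup.

End measurable_rV.

Section measurable_rV_lemmas.
Context {R : realType}.

Lemma measurable_coor n (i : 'I_n) :
  measurable_fun [set: 'rV[R]_n] (fun x : 'rV[R]_n => x ord0 i).
Proof.
move=> _ Y mY; rewrite setTI; apply: sub_sigma_algebra => /=.
rewrite -bigcup_seq/=; exists i => /=; first by rewrite mem_index_enum.
by exists Y => //; rewrite setTI.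
Qed.

Lemma measurable_fun_rV d (T : measurableType d) n (f : T -> 'rV[R]_n) :
  (forall i, measurable_fun [set: T] (fun t => f t ord0 i)) ->
  measurable_fun [set: T] f.
Proof.
move=> mf _ A mA; rewrite setTI.
suff: (@measurable _ 'rV[R]_n) `<=` [set B | measurable (f @^-1` B)] by exact.
apply: smallest_sub => /=.
  split => /=; first by rewrite preimage_set0.
  - by move=> B mB; rewrite setTD preimage_setC; exact: measurableC.
  - by move=> F mF; rewrite preimage_bigcup; exact: bigcupT_measurable.
move=> B; rewrite -bigcup_seq => -[i _ [C mC <-]] /=.
rewrite setTI.
by have := mf i measurableT C mC; rewrite setTI.
Qed.

Definition rV_cons n (p : R * 'rV[R]_n) : 'rV[R]_n.+1 :=
  \row_(i < n.+1) if unlift ord0 i is Some j then p.2 ord0 j else p.1.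

Definition rV_uncons n (x : 'rV[R]_n.+1) : R * 'rV[R]_n :=
  (x ord0 ord0, \row_(j < n) x ord0 (lift ord0 j)).

Lemma rV_consK n : cancel (@rV_cons n) (@rV_uncons n).
Proof.
move=> [a y]; rewrite /rV_uncons /rV_cons mxE unlift_none /=; congr pair.
by apply/rowP => j; rewrite !mxE liftK.
Qed.

Lemma measurable_rV_cons n : measurable_fun setT (@rV_cons n).
Proof.
apply: measurable_fun_rV => i.
rewrite (_ : (fun t => _) = (fun p : R * 'rV[R]_n =>
  if unlift ord0 i is Some j then p.2 ord0 j else p.1)); last first.
  by apply/funext => p; rewrite mxE.
case: unliftP => [j _|_]; last exact: measurable_fst.
exact: (measurableT_comp (@measurable_coor n j) measurable_snd).
Qed.

Lemma measurable_rV_uncons n : measurable_fun setT (@rV_uncons n).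
Proof.
apply/measurable_fun_pairP; split; first exact: (@measurable_coor n.+1 ord0).
apply: measurable_fun_rV => j.
rewrite (_ : (fun t => _) = (fun x : 'rV[R]_n.+1 => x ord0 (lift ord0 j))).
  exact: measurable_coor.
by apply/funext => x; rewrite /= mxE.
Qed.

End measurable_rV_lemmas.

(* The library's sigma-finiteness instance for \x is shadowed by the one for
   subprobabilities. *)
Lemma product_sigma_finite d1 d2 (T1 : measurableType d1)
    (T2 : measurableType d2) (R : realType)
    (m1 : {sigma_finite_measure set T1 -> \bar R})
    (m2 : {sigma_finite_measure set T2 -> \bar R}) :
  sigma_finite setT (m1 \x m2)%E.
Proof.
have /sigma_finiteP[F [TF ndF Foo]] := sigma_finiteT m1.
have /sigma_finiteP[G [TG ndG Goo]] := sigma_finiteT m2.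
exists (fun n => F n `*` G n).
  rewrite -setXTT TF TG predeqE => -[x y]; split.
    move=> [/= [n _ Fnx] [k _ Gky]]; exists (maxn n k) => //; split.
    - by move: x Fnx; exact/subsetPset/ndF/leq_maxl.
    - by move: y Gky; exact/subsetPset/ndG/leq_maxr.
  by move=> [n _ []/= ? ?]; split; exists n.
move=> k; have [? ?] := Foo k; have [? ?] := Goo k.
split; first exact: measurableX.
by rewrite product_measure1E// lte_mul_pinfty// ge0_fin_numE.
Qed.

Section borel_lebesgue.
Context {R : realType}.

Section step.
Variables (n : nat) (mu : {sigma_finite_measure set 'rV[R]_n -> \bar R}).

Definition lebesgue_step : set 'rV[R]_n.+1 -> \bar R :=
  pushforward (lebesgue_measure \x mu)%E (@rV_cons R n).

Let lebesgue_step0 : lebesgue_step set0 = 0%E.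
Proof. by rewrite /lebesgue_step /pushforward preimage_set0 measure0. Qed.

Let lebesgue_step_ge0 A : (0 <= lebesgue_step A)%E.
Proof. by rewrite /lebesgue_step /pushforward; exact: measure_ge0. Qed.

Let lebesgue_step_sigma_additive : semi_sigma_additive lebesgue_step.
Proof.
move=> F mF tF mUF; rewrite /lebesgue_step /pushforward preimage_bigcup.
have mpre B : measurable B -> measurable (@rV_cons R n @^-1` B).
  by move=> mB; have := @measurable_rV_cons R n measurableT B mB; rewrite setTI.
apply: measure_semi_sigma_additive.
- by move=> k; exact: mpre.
- by apply/trivIsetP => /= i j _ _ ij; rewrite -preimage_setI;
    move/trivIsetP : tF => /(_ _ _ _ _ ij) ->//; rewrite preimage_set0.
- by rewrite -preimage_bigcup; exact: mpre.
Qed.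

HB.instance Definition _ := isMeasure.Build _ _ _ lebesgue_step
  lebesgue_step0 lebesgue_step_ge0 lebesgue_step_sigma_additive.

Let lebesgue_step_sigma_finite : sigma_finite setT lebesgue_step.
Proof.
have [F TF mF] := product_sigma_finite (@lebesgue_measure R) mu.
exists (fun k => @rV_uncons R n @^-1` F k).
  by rewrite -preimage_bigcup -TF preimage_setT.
move=> k; have [mFk Fk] := mF k; split.
  by have := @measurable_rV_uncons R n measurableT _ mFk; rewrite setTI.
rewrite /lebesgue_step /pushforward -comp_preimage.
rewrite (_ : _ \o _ = id) //.
by apply/funext => p; exact: rV_consK.
Qed.

HB.instance Definition _ := @Measure_isSigmaFinite.Build _ _ _ lebesgue_step
  lebesgue_step_sigma_finite.

End step.

Fixpoint borel_lebesgue (n : nat) :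
    {sigma_finite_measure set 'rV[R]_n -> \bar R} :=
  match n with
  | 0 => [the {sigma_finite_measure set 'rV[R]_0 -> \bar R} of \d_(0 : 'rV[R]_0)]
  | m.+1 => [the {sigma_finite_measure set 'rV[R]_m.+1 -> \bar R} of
              lebesgue_step (borel_lebesgue m)]
  end.

End borel_lebesgue.

Lemma borel_lebesgue_box (R : realType) (n : nat) (A : 'I_n -> set R) :
  (forall i, measurable (A i)) ->
  borel_lebesgue n [set x : 'rV[R]_n | forall i, A i (x ord0 i)] =
  (\prod_(i < n) lebesgue_measure (A i))%E.
Proof.
elim: n A => [A _|n IHn A mA] /=.
  rewrite big_ord0 (_ : [set _ | _] = setT) ?diracT//.
  by apply/seteqP; split => x _ // -[].
rewrite big_ord_recl -IHn => [|i]; last exact: mA.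
have mAn : measurable [set x : 'rV[R]_n | forall i, A (lift ord0 i) (x ord0 i)].
  rewrite (_ : [set _ | _] = \bigcap_(i in [set: 'I_n])
    ((fun x : 'rV[R]_n => x ord0 i) @^-1` A (lift ord0 i))).
    apply: fin_bigcap_measurable => // i _.
    by have := @measurable_coor R n i measurableT _ (mA (lift ord0 i));
      rewrite setTI.
  apply/seteqP; split => [x /= Ax|x Ax /=]; first by move=> i _; exact: Ax.
  by move=> i; exact: (Ax i I).
rewrite -product_measure1E//; last exact: mA.
rewrite /lebesgue_step /pushforward; congr (_ _).
apply/seteqP; split => [[a y] /= H|[a y] /= [Aa Ay] i].
  split; first by have := H ord0; rewrite mxE unlift_none.
  by move=> i; have := H (lift ord0 i); rewrite mxE liftK.
by rewrite mxE; case: unliftP => [j ->|->].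
Qed.

Section lebesgue.
Context {R : realType} (n : nat).

(* The types R^n and R^n x R^n with their sigma-algebras of Lebesgue measurable
   sets, i.e. the Caratheodory completions of the product sigma-algebras. *)
Definition Rn : measurableType _ :=
  caratheodory_type (mu_ext (@borel_lebesgue R n)).
Definition RnRn : measurableType _ :=
  caratheodory_type
    (mu_ext (@borel_lebesgue R n \x @borel_lebesgue R n)%E).

Definition lebesgue : {measure set Rn -> \bar R} :=
  @completed_measure_extension _ _ _ (@borel_lebesgue R n).
Definition lebesgue2 : {measure set RnRn -> \bar R} :=
  @completed_measure_extension _ _ _ (@borel_lebesgue R n \x @borel_lebesgue R n)%E.

(* The library norm on 'rV[R]_n is the sup norm. *)
Definition enorm (v : 'rV[R]_n) : R := Num.sqrt (\sum_(i < n) v ord0 i ^+ 2).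

(* Support of a function defined up to null sets: the complement of the largest
   open set on which it vanishes almost everywhere.  It is contained in the
   closure of [set x | f x != 0]. *)
Definition ess_support (f : 'rV[R]_n -> \bar R) : set 'rV[R]_n :=
  ~` \bigcup_(U in [set U : set 'rV[R]_n | open U /\
        {ae lebesgue, forall x, U x -> f x = 0%E}]) U.

End lebesgue.
Arguments Rn R n : clear implicits.
Arguments RnRn R n : clear implicits.
Arguments lebesgue R n : clear implicits.
Arguments lebesgue2 R n : clear implicits.

(* Main.v *)
Require Import Defs.
From mathcomp Require Import all_boot all_order all_algebra.
From mathcomp Require Import all_classical all_reals all_analysis.
From mathcomp Require Import measurable_realfun ess_sup_inf.

Import Order.TTheory GRing.Theory Num.Theory.
Import numFieldNormedType.Exports.

Local Open Scope classical_set_scope.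
Local Open Scope ring_scope.

Set Implicit Arguments.
Unset Strict Implicit.

(** The cut-off of [phi] above [M], together with [a >= 0], confines the
    velocities: where [f0 (x, v)] is nonzero, [|v|^2 <= M - Phi x].  If moreover
    [f0] vanishes for almost every [x] outside [B], then almost everywhere
    [g0 (x, v) <= K * 1_{|v|^2 <= w x}], where [w] is [(M - Phi)_+] on [B] and
    [0] elsewhere, and [K] is the product of the bounds of [phi] and [h0].  A
    ball of radius [sqrt (w x)] lies in a cube of side [2 * sqrt (w x)], so
    that, by Tonelli,
      [\iint |v|^k g0 <= K 2^n \int_B (M - Phi)_+^((k + n) / 2)
                      <= K 2^n (C0 (k + n) / 2)^((k + n) / n)]
    for every [k >= 0]: the hypothesis is applied with [p = (k + n) / 2], which
    is at least [1] because [n >= 2].  Taking [k = 0] gives integrability of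
    [g0], taking [k = n^2 - n + 1] the finite moment, and since the exponent
    [(k + n) / n] exceeds [k / n] by just [1], the excess factor is linear in
    [k] and is absorbed in the constant [C1] ([absorb_constants]).

    The rest is measure theory.  The measures are completions, whereas Tonelli's
    theorem concerns the product of the Borel measures, so functions are
    replaced by Borel versions off a Borel null set
    ([measurable_fun_completion_ae], [ge0_integral_completion]).  That [f0]
    vanishes almost everywhere outside [B] requires two facts: a function
    vanishes almost everywhere off its essential support, by the Lindeloef
    property of [R^n] ([ae_ess_support]); and a nonnegative function on the
    product whose integral is zero over almost every fiber above a set of [x]
    vanishes almost everywhere above that set ([ae_eq0_fibers]). *)

(** * Completion of a measure *)

Section completion.
Context {d} {T : measurableType d} {R : realType}.
Variable mu : {measure set T -> \bar R}.
Hypothesis sfmu : sigma_finite [set: T] mu.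

Let C : measurableType _ := caratheodory_type (mu_ext mu).
Let cmu : {measure set C -> \bar R} := @completed_measure_extension d T R mu.

Lemma completion_measurable (A : set T) :
  measurable A -> measurable (A : set C).
Proof. exact: caratheodory_measurable_mu_ext. Qed.

Lemma completionE (A : set T) : measurable A -> cmu A = mu A.
Proof. exact: measurable_mu_extE. Qed.

Lemma completion_complete : measure_is_complete cmu.
Proof. exact: measure_is_complete_caratheodory. Qed.

Lemma measurable_fun_completion d' (Y : measurableType d') (f : T -> Y) :
  measurable_fun [set: T] f -> measurable_fun [set: C] f.
Proof.
by move=> mf _ A mA; apply: completion_measurable; exact: mf.
Qed.

(** The identity is measurable from the completion to the original space, and
    the image of the completed measure under it is the original measure. *)
Lemma ge0_integral_completion (f : T -> \bar R) :
  measurable_fun [set: T] f -> (forall x, 0 <= f x)%E ->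
  (\int[cmu]_x (f : C -> \bar R) x = \int[mu]_x f x)%E.
Proof.
move=> mf f0.
have mi : measurable_fun [set: C] (idfun : C -> T).
  exact: (measurable_fun_completion (@measurable_id _ T setT)).
have /= := @ge0_integral_pushforward _ _ C T R (idfun : C -> T) mi cmu setT f
  measurableT mf.
rewrite preimage_setT => <-; last by move=> x _; exact: f0.
apply: eq_measure_integral => A mA _; exact: completionE.
Qed.

(** If the outer measure of [X] is infinite, the whole space will do.  Otherwise
    the infimum that defines it is attained: the countable covers
    have measurable unions, and the intersection of the unions that are optimal
    up to [1 / (k + 1)] is a cover of least measure. *)
Lemma measurable_hull (X : set T) :
  exists F : set T, [/\ measurable F, X `<=` F & mu F = mu_ext mu X].
Proof.
have [Xoo|Xoo] := eqVneq (mu_ext mu X) +oo%E.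
  exists setT; split => //; rewrite Xoo; apply/eqP; rewrite -leye_eq -Xoo.
  by rewrite -measurable_mu_extE//; exact: le_mu_ext.
have fX : mu_ext mu X \is a fin_num.
  by rewrite ge0_fin_numE ?ltey// mu_ext_ge0.
have /choice[F HF] (k : nat) : exists F : set T, [/\ measurable F, X `<=` F &
    (mu F <= mu_ext mu X + k.+1%:R^-1%:E)%E].
  have k0 : 0 < k.+1%:R^-1 :> R by rewrite invr_gt0.
  have [_ /= [A [mA XA] <-] ltA] := lb_ereal_inf_adherent k0 fX.
  exists (\bigcup_i A i); split => //; first exact: bigcupT_measurable.
  rewrite (le_trans _ (ltW ltA))//.
  by apply: measure_sigma_subadditive => //; exact: bigcupT_measurable.
exists (\bigcap_k F k).
have mF : measurable (\bigcap_k F k).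
  by apply: bigcapT_measurable => k; have [] := HF k.
have XF : X `<=` \bigcap_k F k by move=> x Xx k _; have [_ + _] := HF k; exact.
split => //; apply/eqP; rewrite eq_le; apply/andP; split; last first.
  by rewrite -measurable_mu_extE//; exact: le_mu_ext.
apply/lee_addgt0Pr => e e0.
near \oo => k.
have [mFk _ Fk] := HF k.
apply: (@le_trans _ _ (mu (F k))).
  by apply: le_measure; rewrite ?inE//; exact: bigcap_inf.
rewrite (le_trans Fk)// leeD2l// lee_fin ltW//.
by near: k; exact: near_infty_natSinv_lt (PosNum e0).
Unshelve. all: by end_near. Qed.

Lemma negligible_completion (X : set T) :
  cmu.-negligible X <-> mu.-negligible X.
Proof.
split => [[A [mA A0 XA]]|[A [mA A0 XA]]]; last first.
  by exists A; split => //; [exact: completion_measurable|rewrite completionE].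
have [F [mF AF F0]] := measurable_hull A.
by exists F; split => //; [rewrite F0|exact: subset_trans AF].
Qed.

Lemma ae_completion (P : T -> Prop) :
  {ae cmu, forall x, P x} <-> {ae mu, forall x, P x}.
Proof. exact: negligible_completion. Qed.

(** For [E] of finite measure, let [F] be a measurable hull of [E] and [G] one of
    [F `\` E].  Additivity, which holds because [E] is Caratheodory measurable,
    makes [F `\` E] null, hence also [G].  Sigma-finiteness reduces the
    general case to countably many such sets. *)
Lemma completion_mod_null (E : set C) : measurable E ->
  exists A N : set T, [/\ measurable A, measurable N, mu N = 0%E &
    forall x, ~ N x -> (E x <-> A x)].
Proof.
move=> mE.
have [S TS /all_and2[mS Soo]] := sfmu.
have /choice[AN HAN] (k : nat) : exists AN : set T * set T,
    [/\ measurable AN.1, measurable AN.2, mu AN.2 = 0%E &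
    forall x, ~ AN.2 x -> ((E `&` S k) x <-> AN.1 x)].
  have [F [mF EF F0]] := measurable_hull (E `&` S k).
  have [G [mG FG G0]] := measurable_hull (F `\` (E `&` S k)).
  exists (F, G); split => //=; last first.
    move=> x Gx; split => [/EF//|Fx]; apply: contrapT => Ex.
    by apply: Gx; exact: FG.
  rewrite G0.
  have mES : measurable (E `&` S k : set C).
    by apply: measurableI => //; exact: completion_measurable.
  have ESoo : (cmu (E `&` S k) < +oo)%E.
    apply: (@le_lt_trans _ _ (cmu (S k))).
      by rewrite le_measure ?inE//; exact: completion_measurable.
    by rewrite [X in (X < _)%E](completionE (mS k)).
  change (cmu (F `\` (E `&` S k)) = 0%E).
  rewrite measureD//; last 2 first.
  - exact: completion_measurable.
  - by rewrite [X in (X < _)%E](completionE mF) F0.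
  rewrite setIidr// [X in (X - _)%E](completionE mF) F0; apply: subee.
  by rewrite ge0_fin_numE ?mu_ext_ge0.
exists (\bigcup_k (AN k).1), (\bigcup_k (AN k).2); split.
- by apply: bigcupT_measurable => k; have [] := HAN k.
- by apply: bigcupT_measurable => k; have [] := HAN k.
- apply: measure_negligible.
    by apply: bigcupT_measurable => k; have [] := HAN k.
  apply: negligible_bigcup => k; have [_ mN N0 _] := HAN k.
  by exists (AN k).2; split.
- move=> x Nx; split => [Ex|[k _ Ax]].
    have [k _ Skx] : (\bigcup_k S k) x by rewrite -TS.
    exists k => //; have [_ _ _ /(_ x) []] := HAN k; last by move=> + _; exact.
    by move=> Nkx; apply: Nx; exists k.
  have [_ _ _ /(_ x) []] := HAN k; last by move=> _ /(_ Ax) [].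
  by move=> Nkx; apply: Nx; exists k.
Qed.

(** Each of the countably many sets [f > q], for rational [q], is measurable in
    the original sense off a null set; these sets determine [f], so the union
    of the exceptional sets serves for [f] itself. *)
Lemma measurable_fun_completion_ae (f : T -> R) :
  measurable_fun [set: C] f ->
  exists N : set T, [/\ measurable N, mu N = 0%E & measurable_fun (~` N) f].
Proof.
move=> mf.
have /choice[AN HAN] (q : rat) : exists AN : set T * set T,
    [/\ measurable AN.1, measurable AN.2, mu AN.2 = 0%E &
    forall x, ~ AN.2 x -> (ratr q < f x <-> AN.1 x)].
  have mq : measurable (f @^-1` `]ratr q, +oo[ : set C).
    by rewrite -[X in measurable X]setTI; exact: mf.
  have [A [N [mA mN N0 AN]]] := completion_mod_null mq.
  by exists (A, N); split => //= x Nx; rewrite -AN//= in_itv/= andbT.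
pose N := \bigcup_q (AN q).2.
have mN : measurable N.
  by apply: bigcupT_measurable_rat => q; have [] := HAN q.
exists N; split => //.
  apply: measure_negligible => //.
  (* The rationals are enumerated as a sequence; [0] fills the codes that are
     not attained. *)
  pose g n := odflt 0 (unpickle n) : rat.
  apply: (@negligibleS _ _ _ _ (\bigcup_n (AN (g n)).2)).
    by move=> x [q _ Nx]; exists (pickle q) => //; rewrite /g pickleK.
  apply: negligible_bigcup => k; have [_ mNk N0 _] := HAN (g k).
  by exists (AN (g k)).2; split.
move=> _; apply: (measurability _ (RGenOInfty.measurableE R)) => //;
  last exact: measurableC.
move=> _ [_ [r ->] <-].
rewrite [X in measurable X](_ : _ = ~` N `&`
    \bigcup_(q in [set q : rat | r < ratr q]) (AN q).1).
  apply: measurableI; first exact: measurableC.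
  rewrite bigcup_mkcond; apply: bigcupT_measurable_rat => q.
  by case: ifPn => // _; have [] := HAN q.
apply/seteqP; split => x [Nx /=].
  rewrite in_itv/= andbT => /rat_in_itvoo[q /andP[/= rq qf]].
  rewrite !bnd_simp in rq qf; split => //; exists q => //.
  have [_ _ _ /(_ x)[|+ _]] := HAN q; last by apply.
  by move=> Nqx; apply: Nx; exists q.
move=> [q /= rq Ax]; split => //; rewrite in_itv/= andbT (lt_trans rq)//.
have [_ _ _ /(_ x)[|_]] := HAN q; last by apply.
by move=> Nqx; apply: Nx; exists q.
Qed.

End completion.

(** * Essential support *)

Section essential_support.
Context {R : realType} (n : nat).

(** The open cubes with rational centre and rational half-width form a countable
    basis: this is what makes unions of open null sets null. *)
Lemma rat_box_basis (x : 'rV[R]_n) (U : set 'rV[R]_n) : open U -> U x ->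
  exists i : 'rV[rat]_n * rat,
    let D := [set y : 'rV[R]_n |
      forall j, `|ratr (i.1 ord0 j) - y ord0 j| < ratr i.2] in
    D x /\ D `<=` U.
Proof.
move=> oU Ux.
have /nbhs_ballP[e /= e0 eU] : nbhs x U by exact: open_nbhs_nbhs.
have [r] : exists r : rat, ratr r \in `]0, e / 2[.
  by apply/rat_in_itvoo; rewrite divr_gt0.
rewrite in_itv/= => /andP[r0 re].
have /choice[c Hc] (j : 'I_n) : exists q : rat, `|ratr q - x ord0 j| < ratr r.
  have [q] : exists q : rat, ratr q \in `](x ord0 j - ratr r), (x ord0 j + ratr r)[.
    by apply/rat_in_itvoo; rewrite ltrD2l gtrN.
  by rewrite in_itv/= => qr; exists q; rewrite ltr_distl.
exists (\row_j c j, r) => /=; split => [j|y Hy].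
  by rewrite mxE.
apply: eU; split=> // i j; rewrite ord1.
have := Hy j; rewrite mxE => yj.
rewrite -ball_normE/=.
rewrite (splitr e) -(subrK (ratr (c j)) (x ord0 j)) -addrA.
rewrite (le_lt_trans (ler_normD _ _))// ltrD//.
  by rewrite distrC (lt_trans (Hc j)).
by rewrite (lt_trans yj).
Qed.

(** The complement of the essential support is a possibly uncountable union of
    open sets on which [f] vanishes almost everywhere; it is also the union of
    the countably many rational cubes contained in one of them. *)
Lemma ae_ess_support (f : 'rV[R]_n -> \bar R) :
  {ae lebesgue R n, forall x, ~ ess_support f x -> f x = 0%E}.
Proof.
have aeF : Filter (nbhs (almost_everywhere (lebesgue R n))).
  exact: ae_filter_ringOfSetsType.
pose D (i : 'rV[rat]_n * rat) := [set y : 'rV[R]_n |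
      forall j, `|ratr (i.1 ord0 j) - y ord0 j| < ratr i.2].
(* For each [k], [P k x] holds for almost every [x], trivially so if [f] does not
   vanish almost everywhere on the [k]-th cube. *)
pose P (k : nat) (x : 'rV[R]_n) :=
  if unpickle k is Some i then
    {ae lebesgue R n, forall x, D i x -> f x = 0%E} -> D i x -> f x = 0%E
  else True.
have aeP : {ae lebesgue R n, forall x, forall k, P k x}.
  apply: ae_foralln => k; rewrite /P; case: unpickle => [i|]; last exact: aeW.
  have [H|H] := pselect {ae lebesgue R n, forall x, D i x -> f x = 0%E}.
    by apply: filterS H => x Hx _.
  by apply: aeW.
apply: filterS aeP => x Px.
rewrite /ess_support /setC/= notK => -[U [oU aeU] Ux].
have [i [Dx DU]] := rat_box_basis oU Ux.
have := Px (pickle i); rewrite /P pickleK; apply => //.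
by apply: filterS aeU => y Hy /DU.
Qed.

End essential_support.

(** * Completed product measures *)

(** The integral of a nonnegative function is a supremum over the simple
    functions below it, so it is monotone without any measurability.  This
    matters for the sections of a function that is measurable for a completed
    product measure: only almost all of them are measurable. *)
Lemma ge0_le_integral_nonmeasurable d (T : measurableType d) (R : realType)
    (mu : {measure set T -> \bar R}) (f g : T -> \bar R) :
  (forall x, 0 <= f x)%E -> (forall x, f x <= g x)%E ->
  (\int[mu]_x f x <= \int[mu]_x g x)%E.
Proof.
move=> f0 fg; have g0 x : (0 <= g x)%E := le_trans (f0 x) (fg x).
rewrite !ge0_integralTE//; apply: ereal_sup_le => _ [h hf <-].
by exists h => // x; exact: le_trans (hf x) (fg x).
Qed.

Section product_completion.
Context d1 d2 (T1 : measurableType d1) (T2 : measurableType d2) (R : realType).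
Variables (m1 : {sigma_finite_measure set T1 -> \bar R})
  (m2 : {sigma_finite_measure set T2 -> \bar R}).

Let C1 : measurableType _ := caratheodory_type (mu_ext m1).
Let C12 : measurableType _ := caratheodory_type (mu_ext (m1 \x m2)%E).

Lemma ae_product_fst (P : T1 -> Prop) :
  {ae m1, forall x, P x} -> {ae (m1 \x m2)%E, forall z, P z.1}.
Proof.
move=> [N [mN N0 PN]]; exists (N `*` setT); split.
- exact: measurableX.
- by rewrite product_measure1E// [X in (X * _)%E]N0 mul0e.
- by move=> -[x y] /= Px; split => //; exact: PN.
Qed.

(** Off a null set [N] the function [f] is measurable on [T1] itself, where the
    first projection is measurable; and [N `*` setT] is null, so [f] may be
    modified on it by completeness. *)
Lemma measurable_fun_fst_completion (f : T1 -> R) :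
  measurable_fun [set: C1] f -> measurable_fun [set: C12] (f \o fst).
Proof.
move=> mf.
have [N [mN N0 mfN]] := measurable_fun_completion_ae (sigma_finiteT m1) mf.
pose g := f \_ (~` N).
have mg : measurable_fun setT g.
  exact: (measurable_restrictT f (measurableC mN)).1.
have mgfst : measurable_fun [set: C12] (g \o fst).
  apply: measurable_fun_completion.
  exact: measurableT_comp.
apply/measurable_EFinP.
have cC12 := @completion_complete _ _ R (m1 \x m2)%E.
refine (@ae_measurable_fun _ C12 R _ cC12 setT (EFin \o (g \o fst)) _ _ _);
  last first.
  exact/measurable_EFinP.
apply/ae_completion.
have : {ae (m1 \x m2)%E, forall z, ~ N z.1}.
  by apply: (@ae_product_fst (fun x => ~ N x)); exists N; split => // x /= /contrapT.
apply: filterS => -[x y] /= Nx _.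
by rewrite /g patchE mem_set.
Qed.

End product_completion.

Section fibers.
Context d1 d2 (T1 : measurableType d1) (T2 : measurableType d2) (R : realType).
Variables (m1 : {sigma_finite_measure set T1 -> \bar R})
  (m2 : {sigma_finite_measure set T2 -> \bar R}).

Let C1 : measurableType _ := caratheodory_type (mu_ext m1).
Let C2 : measurableType _ := caratheodory_type (mu_ext m2).
Let C12 : measurableType _ := caratheodory_type (mu_ext (m1 \x m2)%E).
Let cm1 : {measure set C1 -> \bar R} := @completed_measure_extension _ _ R m1.
Let cm2 : {measure set C2 -> \bar R} := @completed_measure_extension _ _ R m2.
Let cm12 : {measure set C12 -> \bar R} :=
  @completed_measure_extension _ _ R (m1 \x m2)%E.

(** A Borel version [G] of [f], set to [0] on a null set, satisfies [0 <= G <= f]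
    everywhere.  Its fiber integrals [J x] are therefore bounded by those of [f],
    whether or not these sections are measurable, and Tonelli applied to [G] on
    the set where [J] vanishes gives the conclusion. *)
Lemma ae_eq0_fibers (f : T1 * T2 -> R) (P : T1 -> Prop) :
  measurable_fun [set: C12] f -> (forall z, 0 <= f z) ->
  {ae cm1, forall x, P x -> (\int[cm2]_v (f (x, v))%:E = 0)%E} ->
  {ae cm12, forall z, P z.1 -> f z = 0}.
Proof.
move=> mf f0 aef.
have [N [mN N0 mfN]] :=
  measurable_fun_completion_ae (product_sigma_finite m1 m2) mf.
pose G := f \_ (~` N).
have mG : measurable_fun setT (EFin \o G).
  apply/measurable_EFinP.
  exact: (measurable_restrictT f (measurableC mN)).1.
have G0 z : (0 <= (EFin \o G) z)%E.
  by rewrite lee_fin /G patchE; case: ifPn.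
have Gf z : G z <= f z by rewrite /G patchE; case: ifPn.
pose J := fubini_F m2 (EFin \o G).
have mJ : measurable_fun setT J by exact: measurable_fun_fubini_tonelli_F.
have Jf x : (J x <= \int[cm2]_v (f (x, v))%:E)%E.
  rewrite /J /fubini_F -(@ge0_integral_completion _ _ _ m2); last 2 first.
  - exact: measurableT_comp.
  - by move=> v; exact: G0.
  apply: ge0_le_integral_nonmeasurable => v; first exact: G0.
  by rewrite lee_fin.
have aeJ : {ae m1, forall x, P x -> J x = 0%E}.
  have aeF : Filter (nbhs (almost_everywhere cm1)).
    exact: ae_filter_ringOfSetsType.
  apply/ae_completion; apply: filterS aef => x /[apply] fx0.
  apply/eqP; rewrite eq_le -[X in (_ <= X)%E]fx0 Jf/=.
  by apply: integral_ge0 => v _; exact: G0.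
pose S := [set x | J x = 0%E].
have mS : measurable S.
  by rewrite -[S]setTI; exact: (@measurable_eqe _ _ _ setT measurableT J (cst 0%E)).
(* [H] restricts [G] to the fibers over which its integral is zero. *)
pose H z := ((EFin \o G) z * (\1_S z.1)%:E)%E.
have mH : measurable_fun setT H.
  apply: emeasurable_funM => //; apply/measurable_EFinP.
  exact: measurableT_comp.
have H0 z : (0 <= H z)%E by rewrite mule_ge0// lee_fin.
have intH : (\int[m1 \x m2]_z `|H z| = 0)%E.
  under eq_integral do rewrite gee0_abs//.
  rewrite fubini_tonelli1//; apply: integral0_eq => x _.
  have [Sx|Sx] := pselect (S x); last first.
    by apply: integral0_eq => v _; rewrite /H/= indicE memNset// mule0.
  rewrite -[RHS]Sx; apply: eq_integral => v _.
  by rewrite /H/= indicE mem_set// mule1.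
have aeH := (ae_eq_integral_abs (m1 \x m2)%E measurableT mH).1 intH.
have aeN : {ae (m1 \x m2)%E, forall z, ~ N z}.
  by exists N; split => // z /contrapT.
apply/ae_completion.
have aeP := ae_product_fst m2 aeJ.
apply: filterS3 aeN aeP aeH => z Nz + + Pz => /(_ Pz) Sz /(_ I).
rewrite /H/= indicE mem_set// mule1 /G patchE mem_set//.
by case.
Qed.

End fibers.

(** * Moments of functions confined to balls *)

Section moments.
Context {R : realType}.

Lemma measurable_enorm n : measurable_fun [set: 'rV[R]_n] (@enorm R n).
Proof.
apply: (measurableT_comp (continuous_measurable_fun (@sqrt_continuous R))).
apply: measurable_sum => i.
by apply: measurable_funX; exact: measurable_coor.
Qed.

Lemma measurable_fun_powR d (T : measurableType d) (f : T -> R) (p : R) :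
  measurable_fun setT f -> measurable_fun setT (fun x => f x `^ p).
Proof.
by move=> mf; apply: (@measurableT_comp _ _ _ T R R (@powR R ^~ p) _ f).
Qed.

(** The Euclidean ball of radius [sqrt u] lies in the cube
    [[- sqrt u, sqrt u]^n]. *)
Lemma borel_lebesgue_ball n (u : R) : 0 <= u ->
  (borel_lebesgue n [set v : 'rV[R]_n | (enorm v ^+ 2 <= u)%R] <=
   ((2 * Num.sqrt u) ^+ n)%:E)%E.
Proof.
move=> u0.
pose A (i : 'I_n) := `[- Num.sqrt u, Num.sqrt u]%classic : set R.
apply: (@le_trans _ _ (borel_lebesgue n
    [set v : 'rV[R]_n | forall i, A i (v ord0 i)])).
  apply: le_measure; rewrite ?inE.
  - rewrite -[X in measurable X]setTI.
    apply: measurable_fun_le => //.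
    by apply: measurable_funX; exact: measurable_enorm.
  - rewrite (_ : [set _ | _] = \bigcap_(i in [set: 'I_n])
      ((fun x : 'rV[R]_n => x ord0 i) @^-1` A i)).
      apply: fin_bigcap_measurable => // i _.
      by rewrite -[X in measurable X]setTI; apply: measurable_coor; rewrite ?/A.
    by apply/seteqP; split => [x /= Ax i _|x Ax i]; [exact: Ax|exact: (Ax i I)].
  - move=> v /= vu i; rewrite /A/= in_itv/= -ler_norml -sqrtr_sqr ler_sqrt//.
    apply: le_trans vu; rewrite sqr_sqrtr ?sumr_ge0// => [|j _]; last exact: sqr_ge0.
    by rewrite (bigD1 i)//= lerDl sumr_ge0// => j _; exact: sqr_ge0.
rewrite borel_lebesgue_box /A// lebesgue_measure_itv/= lte_fin.
have s0 : 0 <= Num.sqrt u by exact: sqrtr_ge0.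
rewrite big_const card_ord.
case: ifPn => _; last first.
  case: n {A} => [|n]/=; first by rewrite expr0.
  by rewrite mul0e lee_fin exprn_ge0// mulr_ge0.
rewrite -EFinB (_ : _ - - _ = 2 * Num.sqrt u); last by rewrite opprK mulr_natl.
set c := 2 * Num.sqrt u; have c0 : 0 <= c by rewrite mulr_ge0.
clearbody c.
elim: n {A} => [|n IHn] /=; first by rewrite expr0.
by rewrite exprS EFinM; apply: lee_wpmul2l; rewrite ?lee_fin.
Qed.

(** By Tonelli the left-hand side is the integral of [u x `^ (k / 2)] times the
    measure of the ball of radius [sqrt (u x)], of order [u x `^ (n / 2)]. *)
Lemma borel_moment_le n (u : 'rV[R]_n -> R) (k : R) : (0 < n)%N ->
  measurable_fun setT u -> (forall x, 0 <= u x) -> 0 <= k ->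
  (\int[borel_lebesgue n \x borel_lebesgue n]_z
      (u z.1 `^ (k / 2) * \1_[set z | enorm z.2 ^+ 2 <= u z.1] z)%:E <=
   (2 ^+ n)%:E * \int[borel_lebesgue n]_x (u x `^ ((k + n%:R) / 2))%:E)%E.
Proof.
move=> n0 mu u0 k0.
pose S : set ('rV[R]_n * 'rV[R]_n) := [set z | enorm z.2 ^+ 2 <= u z.1].
have mS : measurable S.
  rewrite -[X in measurable X]setTI; apply: measurable_fun_le => //.
    apply: measurable_funX; apply: measurableT_comp => //.
    exact: measurable_enorm.
  exact: measurableT_comp.
pose F z := (u z.1 `^ (k / 2) * \1_S z)%:E.
have mF : measurable_fun setT F.
  apply/measurable_EFinP; apply: measurable_funM.
    by apply: measurable_fun_powR; exact: measurableT_comp.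
  exact: measurable_indic.
have F0 z : (0 <= F z)%E by rewrite lee_fin mulr_ge0// powR_ge0.
rewrite (fubini_tonelli1 F mF F0) -ge0_integralZl//; last 2 first.
- by apply/measurable_EFinP; exact: measurable_fun_powR.
- by move=> x _; rewrite lee_fin powR_ge0.
apply: ge0_le_integral => //.
- by move=> x _; exact: integral_ge0.
- exact: measurable_fun_fubini_tonelli_F.
- apply: measurable_funeM.
  by apply/measurable_EFinP; exact: measurable_fun_powR.
move=> x _; rewrite /fubini_F.
have mSx : measurable [set v | S (x, v)].
  rewrite -[X in measurable X]setTI.
  apply: (measurable_fun_le (f := fun v => enorm v ^+ 2) (g := fun=> u x)) => //.
  by apply: measurable_funX; exact: measurable_enorm.
under eq_integral do rewrite /F/= EFinM.
rewrite ge0_integralZl_EFin//=; last 2 first.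
- apply/measurable_EFinP.
  rewrite (_ : (fun v => _) = \1_[set v | S (x, v)] :> (_ -> R)).
    exact: measurable_indic.
  by apply/funext => v; rewrite !indicE; congr (_%:R); apply/idP/idP; rewrite !inE.
- exact: powR_ge0.
rewrite (eq_integral (fun v => (\1_[set v | S (x, v)] v)%:E)); last first.
  by move=> v _; rewrite !indicE; congr (_%:R%:E); apply/idP/idP; rewrite !inE.
rewrite integral_indic// setIT.
apply: (le_trans (lee_wpmul2l _ (borel_lebesgue_ball _ (u0 x)))).
  by rewrite lee_fin powR_ge0.
rewrite -!EFinM lee_fin exprMn mulrCA ler_wpM2l ?exprn_ge0//.
rewrite -powR12_sqrt// -powR_mulrn ?powR_ge0// -powRrM mulrC [_^-1 * _]mulrC.
rewrite -powRD -?mulrDl; first by rewrite addrC.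
by rewrite gt_eqF// divr_gt0// ltr_pwDl// ltr0n.
Qed.

End moments.

Section lebesgue_moments.
Context {R : realType} (n : nat).

Lemma measurable_enorm_snd :
  measurable_fun [set: RnRn R n] (fun z : 'rV[R]_n * 'rV[R]_n => enorm z.2).
Proof.
apply: (@measurable_fun_completion _ _ R (borel_lebesgue n \x borel_lebesgue n)%E).
by apply: (measurableT_comp (@measurable_enorm R n)).
Qed.

(** Passage from [borel_moment_le] to the completed measures: a Borel version [u]
    of [w], set to [0] on a null set, satisfies [u <= w] everywhere and agrees
    with [w] over almost every [x]. *)
Lemma lebesgue2_moment_le (g : 'rV[R]_n * 'rV[R]_n -> R) (w : 'rV[R]_n -> R)
    (K k : R) : (0 < n)%N ->
  measurable_fun [set: RnRn R n] g -> (forall z, 0 <= g z) ->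
  measurable_fun [set: Rn R n] w -> (forall x, 0 <= w x) -> 0 <= K ->
  {ae lebesgue2 R n, forall z,
    g z <= K * \1_[set z | enorm z.2 ^+ 2 <= w z.1] z} -> 0 <= k ->
  (\int[lebesgue2 R n]_z (enorm z.2 `^ k * g z)%:E <=
   (K * 2 ^+ n)%:E * \int[lebesgue R n]_x (w x `^ ((k + n%:R) / 2))%:E)%E.
Proof.
move=> n0 mg g0 mw w0 K0 gw k0.
have aeF : Filter (nbhs (almost_everywhere (lebesgue2 R n))).
  exact: ae_filter_ringOfSetsType.
have [N [mN N0 mwN]] :=
  measurable_fun_completion_ae (sigma_finiteT (borel_lebesgue n)) mw.
pose u := w \_ (~` N).
have mu : measurable_fun setT u := (measurable_restrictT w (measurableC mN)).1 mwN.
have u0 x : 0 <= u x by rewrite /u patchE; case: ifPn.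
have uw x : u x <= w x by rewrite /u patchE; case: ifPn.
pose S : set ('rV[R]_n * 'rV[R]_n) := [set z | enorm z.2 ^+ 2 <= u z.1].
have mS : measurable S.
  rewrite -[X in measurable X]setTI; apply: measurable_fun_le => //.
    apply: measurable_funX; apply: measurableT_comp => //.
    exact: measurable_enorm.
  exact: measurableT_comp.
pose F (z : 'rV[R]_n * 'rV[R]_n) : R := u z.1 `^ (k / 2) * \1_S z.
have mF : measurable_fun setT F.
  apply: measurable_funM.
    by apply: measurable_fun_powR; exact: measurableT_comp.
  exact: measurable_indic.
have F0 z : 0 <= F z by rewrite mulr_ge0// powR_ge0.
have gF : {ae lebesgue2 R n, forall z, enorm z.2 `^ k * g z <= K * F z}.
  have aeN : {ae lebesgue2 R n, forall z, ~ N z.1}.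
    apply/ae_completion; apply: (@ae_product_fst _ _ _ _ _ _ _ (fun x => ~ N x)).
    by exists N; split => // x /contrapT.
  apply: filterS2 aeN gw => z Nz gz.
  have uz : u z.1 = w z.1 by rewrite /u patchE mem_set.
  apply: (le_trans (ler_wpM2l (powR_ge0 _ _) gz)).
  rewrite mulrCA ler_wpM2l// /F !indicE.
  have [zw|/negP zw] := boolP (enorm z.2 ^+ 2 <= w z.1); last first.
    by rewrite !memNset ?mulr0// /S/= uz.
  rewrite !mem_set ?mulr1 /S/= ?uz//.
  have e0 : 0 <= enorm z.2 by exact: sqrtr_ge0.
  apply: (@le_trans _ _ ((enorm z.2 ^+ 2) `^ (k / 2))).
    by rewrite -powR_mulrn// -powRrM mulrCA divff ?mulr1 ?mul1r// pnatr_eq0.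
  by apply: ge0_ler_powR; rewrite ?nnegrE ?divr_ge0 ?sqr_ge0.
apply: (@le_trans _ _ (\int[lebesgue2 R n]_z (K * F z)%:E)%E).
  apply: ae_ge0_le_integral => //.
  - by move=> z _; rewrite lee_fin mulr_ge0// powR_ge0.
  - apply/measurable_EFinP; apply: measurable_funM => //.
    by apply: measurable_fun_powR; exact: measurable_enorm_snd.
  - by move=> z _; rewrite lee_fin mulr_ge0.
  - apply/measurable_EFinP.
    apply: (@measurable_fun_completion _ _ R
      (borel_lebesgue n \x borel_lebesgue n)%E).
    by apply: measurable_funM.
  - by apply: filterS gF => z gz _; rewrite lee_fin.
rewrite (@ge0_integral_completion _ _ R (borel_lebesgue n \x borel_lebesgue n)%E
  (fun z => (K * F z)%:E)); last 2 first.
- by apply/measurable_EFinP; apply: measurable_funM.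
- by move=> z; rewrite lee_fin mulr_ge0.
under eq_integral do rewrite EFinM.
rewrite ge0_integralZl_EFin//; last 2 first.
- by move=> z _; rewrite lee_fin.
- exact/measurable_EFinP.
rewrite EFinM -muleA lee_wpmul2l ?lee_fin//.
apply: (le_trans (borel_moment_le n0 mu u0 k0)).
rewrite lee_wpmul2l ?lee_fin ?exprn_ge0//.
rewrite -(@ge0_integral_completion _ _ R (borel_lebesgue n)); last 2 first.
- by apply/measurable_EFinP; apply: measurable_fun_powR.
- by move=> x; rewrite lee_fin powR_ge0.
apply: ge0_le_integral_nonmeasurable => x; first by rewrite lee_fin powR_ge0.
rewrite lee_fin; apply: ge0_ler_powR; rewrite ?nnegrE//.
by rewrite divr_ge0// addr_ge0.
Qed.

End lebesgue_moments.

(** * Essentially bounded functions *)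

Section essentially_bounded.
Context d (T : measurableType d) (R : realType) (mu : {measure set T -> \bar R}).

(** The norm of order [+oo] is [0] by convention when the whole space is null, in
    which case every bound holds almost everywhere. *)
Lemma Lfun_oo_ae_bounded (f : T -> R) : f \in Lfun mu +oo%E <->
  measurable_fun setT f /\
  exists2 H : R, 0 <= H & {ae mu, forall x, `|f x| <= H}.
Proof.
split => [/andP[mf' /[!inE]/= ]|[mf [H H0 fH]]].
  have mf : measurable_fun setT f by move: mf' => /[!inE].
  rewrite /finite_norm unlock; case: ifPn => [_ foo|]; last first.
    rewrite -leNgt measure_le0 => /eqP muT; split => //.
    by exists 0 => //; exact: measure0_ae.
  split => //.
  have aef := ess_sup_ge mu (abse \o (EFin \o f)).
  exists (Num.max 0 (fine (ess_sup mu (abse \o (EFin \o f))))).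
    by rewrite le_max lexx.
  apply: filterS aef => x /= fx.
  have -> : `|f x| = fine `|(f x)%:E|%E by [].
  rewrite le_max; apply/orP; right; apply: fine_le => //.
  by rewrite fin_numElt foo andbT (lt_le_trans _ fx)// ltNyr.
apply/andP; split; rewrite inE//= /finite_norm unlock; case: ifPn => // _.
apply: (@le_lt_trans _ _ H%:E); last by rewrite ltry.
by apply/ess_supP; apply: filterS fH => x /=; rewrite lee_fin.
Qed.

End essentially_bounded.

(** * Growth of the constants *)

Section constants.
Context {R : realType}.

(** Since [(k + n) / 2 <= k (n + 1) / 2], the left-hand side is at most
    [(e k)^(k / n) * (D e k)] for [e = c (n + 1) / 2].  The last factor is
    exponentially bounded: [D e <= E <= E^k] and [k <= exp k], and
    [E^k = (E^n)^(k / n)], [exp k = (exp 1 ^ n)^(k / n)]. *)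
Lemma absorb_constants (n : nat) (c D : R) : (0 < n)%N -> 0 <= c -> 0 <= D ->
  exists2 C1 : R, 0 <= C1 & forall k : R, 1 <= k ->
    D * (c * ((k + n%:R) / 2)) `^ ((k + n%:R) / n%:R) <= (C1 * k) `^ (k / n%:R).
Proof.
move=> n0 c0 D0.
have nR0 : 0 < n%:R :> R by rewrite ltr0n.
pose e := c * (n%:R + 1) / 2.
have e0 : 0 <= e by rewrite divr_ge0// mulr_ge0// addr_ge0.
pose E := 1 + D * e.
have E1 : 1 <= E by rewrite lerDl mulr_ge0.
have E0 : 0 <= E := le_trans ler01 E1.
exists (e * (E ^+ n * expR 1 ^+ n)).
  by rewrite mulr_ge0// mulr_ge0// exprn_ge0// expR_ge0.
move=> k k1; have k0 : 0 < k := lt_le_trans ltr01 k1.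
have kn0 : 0 <= k / n%:R by rewrite divr_ge0// ltW.
have powX (x : R) : 0 <= x -> (x ^+ n) `^ (k / n%:R) = x `^ k.
  by move=> x0; rewrite -powR_mulrn// -powRrM mulrCA divff ?mulr1// gt_eqF.
have lek : c * ((k + n%:R) / 2) <= e * k.
  rewrite /e -!mulrA ler_wpM2l// [X in _ <= X]mulrCA [_ / 2]mulrC ler_wpM2l//.
  by rewrite mulrDl mul1r addrC lerD2r ler_peMr// ltW.
have ek0 : 0 <= e * k by rewrite mulr_ge0// ltW.
apply: (@le_trans _ _ (D * (e * k) `^ ((k + n%:R) / n%:R))).
  have kn : 0 <= k + n%:R by rewrite addr_ge0// ltW.
  apply: ler_wpM2l => //; apply: ge0_ler_powR; rewrite ?nnegrE//.
    by rewrite divr_ge0.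
  by rewrite mulr_ge0// divr_ge0.
rewrite mulrDl divff ?gt_eqF// powRD; last first.
  by rewrite gt_eqF// ltr_wpDl.
rewrite powRr1// mulrCA.
rewrite [X in _ <= X `^ _](_ : _ = e * k * (E ^+ n * expR 1 ^+ n)); last first.
  by rewrite mulrAC.
have ? : 0 <= E ^+ n by rewrite exprn_ge0.
have ? : 0 <= expR 1 ^+ n :> R by rewrite exprn_ge0// expR_ge0.
rewrite [X in _ <= X]powRM//; last exact: mulr_ge0.
rewrite ler_wpM2l ?powR_ge0//.
rewrite powRM// !powX ?expR_ge0// -expRM mul1r mulrA.
rewrite ler_pM// ?mulr_ge0 ?(ltW k0)//.
  by rewrite (le_trans _ (le1r_powR E1 k1))// /E lerDr.
by rewrite (le_trans _ (expR_ge1Dx k))// lerDr.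
Qed.

End constants.

(** * Moments of the density *)

Unset Implicit Arguments.
Set Strict Implicit.

Theorem proposition4p1 (R : realType) (n : nat) (hn : n = 2%N \/ n = 3%N)
  (phi : R -> R) (M : R)
  (phi_ge0 : forall s, 0 <= phi s)
  (phi_bounded : bounded_fun phi)
  (phi_borel : measurable_fun [set: R] phi)
  (phi_supp : closure [set s | phi s != 0] `<=` [set` `]-oo, M]])
  (Phi : 'rV[R]_n -> R) (a : 'rV[R]_n * 'rV[R]_n -> R)
  (Phi_meas : measurable_fun [set: Rn R n] Phi)
  (a_meas : measurable_fun [set: RnRn R n] a)
  (a_ge0 : forall z, 0 <= a z)
  (B : set 'rV[R]_n)
  (B_meas : @measurable _ (Rn R n) B) :
  let f0 : 'rV[R]_n * 'rV[R]_n -> R :=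
    fun z => phi (enorm z.2 ^+ 2 + Phi z.1 + a z) in
  let rho0 : 'rV[R]_n -> \bar R :=
    fun x => (\int[lebesgue R n]_v (f0 (x, v))%:E)%E in
  compact (ess_support rho0) -> ess_support rho0 `<=` B ->
  (exists C0 : R, 0 <= C0 /\ forall p : R, 1 <= p ->
    (\int[lebesgue R n]_(x in B) (Num.max (M - Phi x) 0 `^ p)%:E
       <= ((C0 * p) `^ (2 * p / n%:R))%:E)%E) ->
  forall h0 : 'rV[R]_n * 'rV[R]_n -> R,
  (forall z, 0 <= h0 z) -> h0 \in Lfun (lebesgue2 R n) +oo%E ->
  let g0 : 'rV[R]_n * 'rV[R]_n -> R := fun z => f0 z * h0 z in
  [/\ forall z, 0 <= g0 z,
      g0 \in Lfun (lebesgue2 R n) 1%E,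
      g0 \in Lfun (lebesgue2 R n) +oo%E,
      exists m : R, (n ^ 2 - n)%:R < m /\
        (\int[lebesgue2 R n]_z (enorm z.2 `^ m * g0 z)%:E < +oo)%E &
      exists C1 : R, 0 <= C1 /\ forall k : R, 1 <= k ->
        (\int[lebesgue2 R n]_z (enorm z.2 `^ k * g0 z)%:E
           <= ((C1 * k) `^ (k / n%:R))%:E)%E].
Proof.
have n0 : (0 < n)%N by case: hn => ->.
move=> f0 rho0 _ suppB [C0 [C00 momB]] h0 h0_ge0 h0oo g0.
have aeF : Filter (nbhs (almost_everywhere (lebesgue2 R n))).
  exact: ae_filter_ringOfSetsType.
have aeF1 : Filter (nbhs (almost_everywhere (lebesgue R n))).
  exact: ae_filter_ringOfSetsType.
have [/= mh0 [H H0 h0H]] := (Lfun_oo_ae_bounded _ _).1 h0oo.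
have [A A0 phiA] : exists2 A : R, 0 <= A & forall s, phi s <= A.
  have [A [_ phiA]] := phi_bounded.
  exists (Num.max 0 (A + 1)); first by rewrite le_max lexx.
  move=> s; rewrite le_max; apply/orP; right.
  by rewrite (le_trans (ler_norm _))//; apply: phiA; rewrite ?ltrDl.
have f0_ge0 z : 0 <= f0 z by exact: phi_ge0.
have g0_ge0 z : 0 <= g0 z by exact: mulr_ge0.
have mf0 : measurable_fun [set: RnRn R n] f0.
  apply: (measurableT_comp phi_borel).
  apply: measurable_funD => //; apply: measurable_funD.
    by apply: measurable_funX; exact: measurable_enorm_snd.
  exact: (@measurable_fun_fst_completion _ _ _ _ _
    (borel_lebesgue n) (borel_lebesgue n) _ Phi_meas).
have mg0 : measurable_fun [set: RnRn R n] g0 by exact: measurable_funM.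
have f0_supp z : f0 z != 0 -> enorm z.2 ^+ 2 <= M - Phi z.1.
  move=> /(@subset_closure _ [set s | phi s != 0]) /phi_supp /=.
  rewrite in_itv/= => fM; rewrite lerBrDr (le_trans _ fM)//.
  by rewrite lerDl.
have f0B : {ae lebesgue2 R n, forall z, ~ B z.1 -> f0 z = 0}.
  apply: (@ae_eq0_fibers _ _ _ _ _ (borel_lebesgue n) (borel_lebesgue n) f0
    (fun x => ~ B x) mf0 f0_ge0).
  by apply: filterS (ae_ess_support rho0) => x + Bx; apply => /suppB.
pose w := (fun x => Num.max (M - Phi x) 0) \_ B.
have mw : measurable_fun [set: Rn R n] w.
  apply: (measurable_restrictT (_ : Rn R n -> R) B_meas).1.
  apply: measurable_funTS; apply: measurable_maxr => //.
  exact: measurable_funB.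
have w0 x : 0 <= w x.
  by rewrite /w patchE; case: ifPn => // _; rewrite le_max lexx orbT.
have gw : {ae lebesgue2 R n, forall z,
    g0 z <= A * H * \1_[set z | enorm z.2 ^+ 2 <= w z.1] z}.
  apply: filterS2 f0B h0H => z fBz hz.
  have [f0z|f0z] := eqVneq (f0 z) 0.
    by rewrite /g0 f0z mul0r mulr_ge0// mulr_ge0.
  have Bz : B z.1 by apply: contrapT => /fBz/eqP; rewrite (negbTE f0z).
  rewrite indicE mem_set/=; last first.
    by rewrite /w patchE mem_set// le_max f0_supp.
  rewrite mulr1; apply: ler_pM => //; first exact: phiA.
  by rewrite -[X in X <= _]ger0_norm.
(* The exponent [p = (k + n) / 2] satisfies [2 p / n = (k + n) / n]; outside [B]
   the powers of [w] vanish because [p] is nonzero. *)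
have mom k : 0 <= k -> (\int[lebesgue2 R n]_z (enorm z.2 `^ k * g0 z)%:E <=
    (A * H * 2 ^+ n * (C0 * ((k + n%:R) / 2)) `^ ((k + n%:R) / n%:R))%:E)%E.
  move=> k0.
  have AH0 : 0 <= A * H by exact: mulr_ge0.
  apply: (le_trans (lebesgue2_moment_le n0 mg0 g0_ge0 mw w0 AH0 gw k0)).
  rewrite [X in (_ <= X)%E]EFinM lee_wpmul2l ?lee_fin ?mulr_ge0 ?exprn_ge0//.
  have p1 : 1 <= (k + n%:R) / 2.
    by rewrite ler_pdivlMr// mul1r ler_wpDl// ler_nat; case: hn => ->.
  have := momB _ p1; rewrite [2 * _]mulrC divfK ?pnatr_eq0//; apply: le_trans.
  rewrite le_eqVlt; apply/orP; left; apply/eqP.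
  rewrite [RHS]integral_mkcond; apply: eq_integral => x _.
  rewrite /w !patchE; case: ifPn => // _.
  by rewrite powR0// gt_eqF// (lt_le_trans _ p1).
split => //.
- apply/andP; split; rewrite inE//= /finite_norm Lnorm1.
  rewrite (@le_lt_trans _ _ (\int[lebesgue2 R n]_z (enorm z.2 `^ 0 * g0 z)%:E)%E)//.
    rewrite le_eqVlt; apply/orP; left; apply/eqP; apply: eq_integral => z _.
    by rewrite /= powRr0 mul1r ger0_norm.
  by rewrite (le_lt_trans (mom _ (lexx 0)))// ltry.
- apply/Lfun_oo_ae_bounded; split => //; exists (A * H); first exact: mulr_ge0.
  apply: filterS gw => z gz; rewrite ger0_norm// (le_trans gz)//.
  by rewrite ler_piMr ?mulr_ge0// indicE; case: (_ \in _).
- exists (n ^ 2 - n).+1%:R; split; first by rewrite ltr_nat.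
  by rewrite (le_lt_trans (mom _ (ler0n _ _)))// ltry.
- have D0 : 0 <= A * H * 2 ^+ n by rewrite !mulr_ge0// exprn_ge0.
  have [C1 C10 HC1] := absorb_constants n0 C00 D0.
  exists C1; split => // k k1; apply: (le_trans (mom _ (le_trans ler01 k1))).
  by rewrite lee_fin; exact: HC1.
Qed.
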